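(* For any complete bipartite graph $K_{r,t}$ ($r,t\ge 1$) different from $K_{1,1}$, $$edim(K_{r,t})=dim(K_{r,t})=r+t-2.$$
   Context: All graphs are finite and simple. $K_{r,t}$ is the complete bipartite graph with partite sets of sizes $r$ and $t$. For a connected graph $G=(V,E)$, $d_G(x,y)$ is the length of a shortest path between vertices $x,y$. A vertex $v$ distinguishes two vertices $x,y$ if $d_G(v,x)\neq d_G(v,y)$. A set $S\subseteq V$ is a metric generator for $G$ if any two distinct vertices of $G$ are distinguished by some element of $S$; the metric dimension $dim(G)$ is the minimum cardinality of a metric generator. The distance between a vertex $v$ and an edge $e=uw$ is $d_G(e,v)=\min\{d_G(u,v),d_G(w,v)\}$. A vertex $w$ distinguishes two edges $e_1,e_2$ if $d_G(w,e_1)\ne d_G(w,e_2)$. A set $S\subseteq V$ is an edge metric generator for $G$ if every two distinct edges of $G$ are distinguished by some vertex of $S$; the edge metric dimension $edim(G)$ is the smallest cardinality of an edge metric generator for $G$. *)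

(* Defs.v *)
From mathcomp Require Import all_boot.

Set Implicit Arguments.
Unset Strict Implicit.
Unset Printing Implicit Defensive.

Record sgraph := SGraph {
  vertex :> finType;
  adj : rel vertex;
  adj_sym : symmetric adj;
  adj_irrefl : irreflexive adj }.

Section Distance.

Variable G : sgraph.
Implicit Types (x y v w : G) (e : {set G}) (S : {set G}).

(* There is a path with n edges from x to y; the tuple p lists its vertices
   other than x, in order. *)
Definition has_path x y (n : nat) : bool :=
  [exists p : n.-tuple G,
     [&& path (@adj G) x p, last x p == y & uniq (x :: p)]].

(* A path has fewer than #|G| edges, so the range is large enough.  The value
   is #|G| when no path joins x to y, which does not happen when G is
   connected. *)
Definition dist x y : nat :=
  [arg min_(n < ord_max | has_path x y n) (n : 'I_#|G|.+1)].

Definition edges : {set {set G}} :=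
  [set e | [exists u : G, exists w : G, adj u w && (e == [set u; w])]].

(* The default value #|G| of the minimum is an upper bound of dist, so it does
   not affect the minimum over the two ends of an edge: see edge_distE. *)
Definition edge_dist e v : nat := \big[minn/#|G|]_(u in e) dist u v.

Definition distinguishes v x y : bool := dist v x != dist v y.

Definition metric_generator S : bool :=
  [forall x : G, forall y : G,
     (x != y) ==> [exists v in S, distinguishes v x y]].

Definition edge_distinguishes w e1 e2 : bool :=
  edge_dist e1 w != edge_dist e2 w.

Definition edge_metric_generator S : bool :=
  [forall e1 in edges, forall e2 in edges,
     (e1 != e2) ==> [exists w in S, edge_distinguishes w e1 e2]].

(* In both definitions below the default set [set: G] is itself a generator
   (metric_generatorT and edge_metric_generatorT), so that the minimum is
   always attained at a generator. *)
Definition metric_dim : nat :=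
  #|[arg min_(S < [set: G] | metric_generator S) #|S|]|.

Definition edge_metric_dim : nat :=
  #|[arg min_(S < [set: G] | edge_metric_generator S) #|S|]|.

Lemma dist_le x y : dist x y <= #|G|.
Proof. by rewrite -ltnS ltn_ord. Qed.

Lemma dist_path_or_max x y : has_path x y (dist x y) \/ dist x y = #|G|.
Proof.
rewrite /dist /arg_min /extremum.
by case: pickP => [i /andP[hp _] | _]; [left | right].
Qed.

Lemma dist_min x y n : has_path x y n ->
  has_path x y (dist x y) /\ dist x y <= n.
Proof.
move=> hn; have n_lt : n < #|G|.+1.
  have /existsP[p /and3P[_ _ /card_uniqP E]] := hn.
  apply: leqW; have := max_card [in x :: p].
  by rewrite E /= size_tuple.
rewrite /dist /arg_min /extremum; case: pickP => [i /andP[hp /forallP h] | no].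
  by split=> //; apply: (implyP (h (Ordinal n_lt))).
have [i hi mi] := @arg_minnP _ (Ordinal n_lt)
  (fun k : 'I_#|G|.+1 => has_path x y k) (fun k => nat_of_ord k) hn.
have /negP[] := negbT (no i); rewrite /= hi.
by apply/forallP => j; apply/implyP => /mi.
Qed.

Lemma dist_eq0 x y : (dist x y == 0) = (x == y).
Proof.
apply/idP/eqP => [/eqP d0 | <-{y}].
  have [] := dist_path_or_max x y; rewrite d0; last first.
    by move/esym/card0_eq/(_ x).
  by case/existsP => p /and3P[_ /eqP + _]; rewrite (tuple0 p).
rewrite -leqn0; have [] // := @dist_min x x 0.
by apply/existsP; exists [tuple]; rewrite /= eqxx.
Qed.

Lemma edge_distE u w v :
  edge_dist [set u; w] v = minn (dist u v) (dist w v).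
Proof.
rewrite /edge_dist; apply/eqP; rewrite eqn_leq; apply/andP; split.
  have le_big z : z \in [set u; w] ->
      \big[minn/#|G|]_(a in [set u; w]) dist a v <= dist z v.
    move=> zP; rewrite -big_filter.
    have : z \in [seq a <- index_enum G | a \in [set u; w]].
      by rewrite mem_filter zP mem_index_enum.
    elim: [seq _ <- _ | _] => // a s IHs; rewrite inE big_cons geq_min.
    by case/predU1P => [<-|/IHs->]; rewrite ?leqnn ?orbT.
  by rewrite leq_min !le_big // !inE eqxx ?orbT.
elim/big_ind: _ => [|a b ha hb|z]; first by rewrite geq_min dist_le.
  by rewrite leq_min ha.
by rewrite !inE => /orP[] /eqP->; rewrite geq_min leqnn ?orbT.
Qed.

Lemma metric_generatorT : metric_generator [set: G].
Proof.
apply/forallP => x; apply/forallP => y; apply/implyP => xy.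
apply/existsP; exists x; rewrite inE /=; apply/eqP => E.
have := dist_eq0 x x; rewrite eqxx E dist_eq0 => /eqP/eqP.
by rewrite (negbTE xy).
Qed.

Lemma edge_dist_eq0 e v : e \in edges -> (edge_dist e v == 0) = (v \in e).
Proof.
rewrite inE => /existsP[u /existsP[w /andP[_ /eqP->]]].
rewrite edge_distE -leqn0 geq_min !leqn0 !dist_eq0 !inE.
by rewrite ![v == _]eq_sym.
Qed.

Lemma edge_metric_generatorT : edge_metric_generator [set: G].
Proof.
apply/forallP => e1; apply/implyP => h1; apply/forallP => e2; apply/implyP => h2.
apply/implyP; apply: contraR => /existsPn h; apply/eqP/setP => v.
have := h v; rewrite inE negbK => /eqP E.
by rewrite -!edge_dist_eq0 // E.
Qed.

End Distance.

Section CompleteBipartite.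

Variables r t : nat.

Definition Kadj (x y : 'I_r + 'I_t) : bool :=
  match x, y with
  | inl _, inr _ | inr _, inl _ => true
  | _, _ => false
  end.

Lemma Kadj_sym : symmetric Kadj. Proof. by case=> ? []. Qed.

Lemma Kadj_irrefl : irreflexive Kadj. Proof. by case. Qed.

Definition complete_bipartite : sgraph := SGraph Kadj_sym Kadj_irrefl.

End CompleteBipartite.

Notation "''K_' ( r , t )" := (complete_bipartite r t)
  (at level 8, format "''K_' ( r ,  t )").

(* Main.v *)
Require Import Defs.
From mathcomp Require Import all_boot.

Set Implicit Arguments.
Unset Strict Implicit.
Unset Printing Implicit Defensive.

(** Both dimensions are governed by the same covering condition.  Two distinct
vertices x, y on the same side of K_{r,t} are twins: every other vertex is at
the same distance from x and from y.  Hence a metric generator contains x or y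
([metric_generator_twin_cover]).  The distance from a vertex to an edge is 0 or
1 according to incidence ([K_edge_dist]), so for a common neighbour z of x and
y the edges xz and yz are also distinguished by x and y only, and an edge
metric generator contains x or y as well ([edge_metric_generator_twin_cover]).
A set meeting all pairs of twins misses at most one vertex on each side, so it
has at least r + t - 2 elements ([twin_cover_card]).

Conversely, let S be obtained by removing one vertex from each side.
Two distinct vertices of which one is in S are distinguished by that one; the
two removed vertices are on opposite sides, and any vertex of S distinguishes
them, S being nonempty since the graph is not K_{1,1}
([minus_edge_metric_generator]).  Two distinct edges differ at their end on some
side, and one of these two ends is in S and lies on only one of the edges
([minus_edge_edge_metric_generator]). *)

Lemma card_arg_min (T : finType) (P : pred {set T}) (S0 : {set T}) :
  P [set: T] -> P S0 -> (forall S, P S -> #|S0| <= #|S|) ->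
  #|[arg min_(S < [set: T] | P S) #|S|]| = #|S0|.
Proof.
move=> PT P0 min0; case: arg_minnP => // S PS minS.
by apply/eqP; rewrite eqn_leq minS //= min0.
Qed.

Section DistanceComplements.

Variable G : sgraph.
Implicit Types x y z : G.

(** When dist takes its default value #|G| = 1, the graph is a single vertex,
at distance 0 from itself; so the value 1 always comes from an edge. *)
Lemma dist_eq1 x y : (dist x y == 1) = adj x y.
Proof.
apply/eqP/idP => [d1 | xy].
  have [] := dist_path_or_max x y; rewrite d1.
    case/existsP; case/tupleP => z p; rewrite tuple0 /=.
    by case/and3P=> /andP[xz _] /eqP <-.
  move/esym/eqP/fintype1P => [z Gz].
  by have := dist_eq0 x y; rewrite d1 (Gz x) (Gz y) eqxx.
have xDy : x != y by apply: contraTneq xy => ->; rewrite adj_irrefl.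
have [|_ d_le1] := @dist_min _ x y 1.
  by apply/existsP; exists [tuple y]; rewrite /= xy eqxx inE xDy.
by apply/eqP; rewrite eqn_leq d_le1 lt0n dist_eq0.
Qed.

Lemma dist_eq2 x y z :
  x != y -> ~~ adj x y -> adj x z -> adj z y -> dist x y = 2.
Proof.
move=> xDy nxy xz zy; apply/eqP; rewrite eqn_leq; apply/andP; split.
  have xDz : x != z by apply: contraTneq xz => ->; rewrite adj_irrefl.
  have zDy : z != y by apply: contraTneq zy => ->; rewrite adj_irrefl.
  have [|_ //] := @dist_min _ x y 2.
  apply/existsP; exists [tuple z; y].
  by rewrite /= xz zy eqxx !inE negb_or xDz xDy zDy.
rewrite ltn_neqAle lt0n dist_eq0 xDy andbT eq_sym.
by rewrite dist_eq1.
Qed.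

Lemma edge_set2 x y : adj x y -> [set x; y] \in edges G.
Proof.
by move=> xy; rewrite inE; apply/existsP; exists x; apply/existsP; exists y;
  rewrite xy eqxx.
Qed.

End DistanceComplements.

Section CompleteBipartite.

Variables r t : nat.
Hypotheses (hr : 1 <= r) (ht : 1 <= t).

Local Notation K := ('K_(r, t)).

Implicit Types (x y z v : K) (S e : {set K}).

Lemma K_common_neighbour x y : ~~ adj x y -> exists2 z, adj x z & adj z y.
Proof.
case: x y => [i|j] [i'|j'] //= _.
- by exists (inr (Ordinal ht)).
- by exists (inl (Ordinal hr)).
Qed.

Lemma K_dist x y : dist x y = if x == y then 0 else if adj x y then 1 else 2.
Proof.
case: ifPn => [|xDy]; first by rewrite -dist_eq0 => /eqP.
case: ifPn => [|nxy]; first by rewrite -dist_eq1 => /eqP.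
by have [z] := K_common_neighbour nxy; apply: dist_eq2.
Qed.

(** Every vertex is adjacent to the end on the opposite side, so the distance
to an edge never exceeds 1. *)
Lemma K_edge_dist e v : e \in edges K -> edge_dist e v = (v \notin e).
Proof.
move=> eK; have := edge_dist_eq0 v eK.
case: (v \in e) => [/eqP //|/negbT]; rewrite -lt0n => d_gt0.
apply/eqP; rewrite eqn_leq d_gt0 andbT.
move: eK; rewrite inE => /existsP[u /existsP[w /andP[uw /eqP->]]].
rewrite edge_distE geq_min.
have /orP[] : adj u v || adj w v by case: u w v uw {d_gt0} => [?|?] [?|?] [].
- by rewrite -dist_eq1 => /eqP->.
- by rewrite -dist_eq1 => /eqP->; rewrite orbT.
Qed.

Definition twin_cover S : Prop :=
  forall x y, x != y -> ~~ adj x y -> (x \in S) || (y \in S).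

(** The side is injective on the complement of a twin cover, so at most two
vertices are missed. *)
Lemma twin_cover_card S : twin_cover S -> r + t - 2 <= #|S|.
Proof.
move=> coverS; pose side (x : K) := if x is inl _ then true else false.
have side_inj : {in ~: S &, injective side}.
  move=> x y; rewrite !inE => xS yS xy; apply/eqP; apply: contraT => xDy.
  have nxy : ~~ adj x y by case: x y xy {xS yS xDy} => [?|?] [].
  by have := coverS x y xDy nxy; rewrite (negbTE xS) (negbTE yS).
have := leq_card_in side _ side_inj; rewrite card_bool => le2.
have -> : r + t = #|S| + #|~: S|.
  by rewrite cardsC card_sum !card_ord.
by rewrite leq_subLR addnC leq_add2r.
Qed.

Lemma metric_generator_twin_cover S : metric_generator S -> twin_cover S.
Proof.
move=> /forallP genS x y xDy nxy.
have /forallP/(_ y)/implyP/(_ xDy)/existsP[v /andP[vS]] := genS x.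
apply: contraLR; rewrite negb_or => /andP[xS yS].
rewrite /distinguishes negbK !K_dist.
have /negbTE-> : v != x by apply: contraNneq xS => <-.
have /negbTE-> : v != y by apply: contraNneq yS => <-.
by case: x y v nxy {xDy xS yS vS} => [?|?] [?|?] [].
Qed.

Lemma edge_metric_generator_twin_cover S :
  edge_metric_generator S -> twin_cover S.
Proof.
move=> /forall_inP genS x y xDy nxy.
have [z xz] := K_common_neighbour nxy; rewrite adj_sym => yz.
have [exz eyz] := (edge_set2 xz, edge_set2 yz).
have xz_yz : [set x; z] != [set y; z].
  apply/eqP => /setP/(_ x); rewrite !inE eqxx (negbTE xDy) /=.
  by move/esym/eqP => E; rewrite E adj_irrefl in xz.
have /forall_inP/(_ _ eyz)/implyP/(_ xz_yz)/existsP[v /andP[vS]] := genS _ exz.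
apply: contraLR; rewrite negb_or => /andP[xS yS].
rewrite /edge_distinguishes negbK !K_edge_dist // !inE.
have /negbTE-> : v != x by apply: contraNneq xS => <-.
by have /negbTE-> : v != y by apply: contraNneq yS => <-.
Qed.

Definition minus_edge : {set K} :=
  ~: [set inl (Ordinal hr); inr (Ordinal ht)].

Lemma card_minus_edge : #|minus_edge| = r + t - 2.
Proof.
have <- : #|K| = r + t by rewrite card_sum !card_ord.
by rewrite cardsCs setCK cards2.
Qed.

Lemma removed_adj x y : x \notin minus_edge -> y \notin minus_edge ->
  x != y -> adj x y.
Proof.
by rewrite !inE !negbK => /orP[]/eqP-> /orP[]/eqP->; rewrite // eqxx.
Qed.

Lemma minus_edge_metric_generator : 0 < r + t - 2 -> metric_generator minus_edge.
Proof.
rewrite -card_minus_edge card_gt0 => /set0Pn[v vS].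
apply/forallP => x; apply/forallP => y; apply/implyP => xDy.
have [xS|xS] := boolP (x \in minus_edge).
  apply/existsP; exists x; rewrite xS /distinguishes.
  by rewrite !K_dist eqxx (negbTE xDy); case: ifP.
have [yS|yS] := boolP (y \in minus_edge).
  apply/existsP; exists y; rewrite yS /distinguishes.
  by rewrite !K_dist eqxx [y == x]eq_sym (negbTE xDy); case: ifP.
have xy := removed_adj xS yS xDy.
apply/existsP; exists v; rewrite vS /distinguishes !K_dist.
have /negbTE-> : v != x by apply: contraNneq xS => <-.
have /negbTE-> : v != y by apply: contraNneq yS => <-.
by case: x y v xy {xDy xS yS vS} => [?|?] [?|?] [].
Qed.

Lemma edgeP e : e \in edges K -> exists i j, e = [set inl i; inr j].
Proof.
rewrite inE => /existsP[[i|j] /existsP[[i'|j'] /andP[//= _ /eqP->]]].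
- by exists i, j'.
- by exists i', j; rewrite setUC.
Qed.

(** Only the two removed vertices, which are adjacent, are outside the set, so
of two distinct ends on the same side one is available. *)
Lemma minus_edge_edge_metric_generator : edge_metric_generator minus_edge.
Proof.
apply/forall_inP => e1 e1K; apply/forall_inP => e2 e2K; apply/implyP.
apply: contraR => /existsPn no_dist; apply/eqP.
have same v : v \in minus_edge -> (v \in e1) = (v \in e2).
  move=> vS; have := no_dist v.
  rewrite vS negbK /edge_distinguishes !K_edge_dist //.
  by do 2!case: (v \in _).
have [i1 [j1 E1]] := edgeP e1K; have [i2 [j2 E2]] := edgeP e2K.
(* Two ends on the same side that each lie on only one edge must coincide,
   since both would have been removed. *)
have ends x y : x \in e1 -> y \in e2 -> x \notin e2 -> y \notin e1 ->
    ~~ adj x y -> x = y.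
  move=> xe1 ye2 xe2 ye1; apply: contraNeq; apply: removed_adj.
  - by apply: contraNN xe2 => /same <-.
  - by apply: contraNN ye1 => /same ->.
have i12 : i1 = i2.
  apply/eqP; apply: contraT => iD.
  have [] : inl i1 = inl i2 :> K; last by move/eqP; rewrite (negbTE iD).
  by apply: ends; rewrite // ?E1 ?E2 !inE ?eqxx //= orbF
    (inj_eq (@inl_inj _ _)) // eq_sym.
have j12 : j1 = j2.
  apply/eqP; apply: contraT => jD.
  have [] : inr j1 = inr j2 :> K; last by move/eqP; rewrite (negbTE jD).
  by apply: ends; rewrite // ?E1 ?E2 !inE ?eqxx //=
    (inj_eq (@inr_inj _ _)) // eq_sym.
by rewrite E1 E2 i12 j12.
Qed.

End CompleteBipartite.

Unset Implicit Arguments.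

Theorem mainTheorem7 (r t : nat) (hr : 1 <= r) (ht : 1 <= t)
    (hK : (r, t) <> (1, 1)) :
  edge_metric_dim 'K_(r, t) = metric_dim 'K_(r, t) /\
  metric_dim 'K_(r, t) = r + t - 2.
Proof.
have rt_gt2 : 0 < r + t - 2.
  by case: r t hr ht hK => [|[|r']] [|[|t']] //= _ _ _; rewrite subn_gt0 ?addnS.
have dimK : metric_dim 'K_(r, t) = r + t - 2.
  rewrite -(card_minus_edge hr ht); apply: card_arg_min.
  - exact: metric_generatorT.
  - exact: minus_edge_metric_generator.
  - move=> S /(metric_generator_twin_cover hr ht) /twin_cover_card.
    by rewrite card_minus_edge.
split=> //; rewrite dimK -(card_minus_edge hr ht); apply: card_arg_min.
- exact: edge_metric_generatorT.
- exact: minus_edge_edge_metric_generator.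
- move=> S /(edge_metric_generator_twin_cover hr ht) /twin_cover_card.
  by rewrite card_minus_edge.
Qed.
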